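(* Let $t\ge1$ be an integer and $L_t:=1-\lambda_N(W^t)$, where $\lambda_N(W^t)$ is the smallest eigenvalue of $W^t$. Then for all $\mathbf{x},\mathbf{y}\in\mathrm{St}(d,r)^N$, $$\varphi^t(\mathbf{y})-\big[\varphi^t(\mathbf{x})+\langle\mathrm{grad}\,\varphi^t(\mathbf{x}),\mathbf{y}-\mathbf{x}\rangle\big]\le\frac{L_t}{2}\|\mathbf{y}-\mathbf{x}\|_F^2.$$
   Context: Let $1\le r\le d$ and $N\ge2$ be integers and $\mathrm{St}(d,r)=\{x\in\mathbb{R}^{d\times r}:x^\top x=I_r\}$. Inner products are $\langle x,y\rangle=\mathrm{Tr}(x^\top y)$ and $\|\cdot\|_F$ is the Frobenius norm, applied also to stacked tuples $\mathbf{x}=(x_1,\dots,x_N)$. $W\in\mathbb{R}^{N\times N}$ is the communication matrix of a connected undirected graph on $N$ nodes; it is symmetric and doubly stochastic, $W_{ij}\ge0$, $0<W_{ii}<1$, its eigenvalues lie in $(-1,1]$, and its second largest singular value lies in $[0,1)$. $W^t_{ij}$ is the $(i,j)$ entry of the $t$-th power $W^t$. $\varphi^t(\mathbf{x})=\frac14\sum_{i,j=1}^N W^t_{ij}\|x_i-x_j\|_F^2$. The Euclidean gradient has blocks $\nabla\varphi^t_i(\mathbf{x})=x_i-\sum_{j}W^t_{ij}x_j$, and the Riemannian gradient on $\mathrm{St}(d,r)^N$ has blocks $\mathrm{grad}\,\varphi^t_i(\mathbf{x})=\mathcal{P}_{T_{x_i}}(\nabla\varphi^t_i(\mathbf{x}))$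 with $\mathcal{P}_{T_x}(y)=y-\frac12x(x^\top y+y^\top x)$. *)

(* Defs.v *)
From mathcomp Require Import all_boot all_order all_algebra.
From mathcomp Require Import boolp classical_sets reals.

Set Implicit Arguments.
Unset Strict Implicit.
Unset Printing Implicit Defensive.

Import Order.TTheory GRing.Theory Num.Theory.

Local Open Scope classical_set_scope.
Local Open Scope ring_scope.

Section Spectrum.
Context {R : realType} {n : nat}.
Implicit Types A : 'M[R]_n.

(* Junk value 0 when A has no real eigenvalue. *)
Definition smallest_eigenvalue A : R :=
  xget 0 [set a | eigenvalue A a /\ (forall b, eigenvalue A b -> a <= b)].

Lemma smallest_eigenvalueP A a : eigenvalue A a ->
  eigenvalue A (smallest_eigenvalue A) /\
  (forall b, eigenvalue A b -> smallest_eigenvalue A <= b).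
Proof.
move=> Aa; rewrite /smallest_eigenvalue; case: xgetP => [m _ //|noMin].
have step b : eigenvalue A b -> exists2 c, eigenvalue A c & c < b.
  move=> Ab; apply: contrapT => nc; apply: (noMin b); split=> // c Ac.
  by rewrite leNgt; apply/negP => ltcb; apply: nc; exists c.
have chain k : exists b s, [/\ size s = k, path <%R b s
    & all (eigenvalue A) (b :: s)].
  elim: k => [|k [b [s [szs ps /= /andP[Ab As]]]]].
    by exists a, [::]; split; rewrite //= Aa.
  have [c Ac ltcb] := step b Ab.
  by exists c, (b :: s); split; rewrite /= ?szs ?ltcb ?Ac ?Ab.
have [b [s [szs ps As]]] := chain n.
have: (size (b :: s) < size (char_poly A))%N.
  apply: max_poly_roots.
  - exact: monic_neq0 (char_poly_monic A).
  - by apply/allP => c /(allP As); rewrite eigenvalue_root_char.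
  - exact: (lt_sorted_uniq (s := b :: s)).
by rewrite size_char_poly /= szs ltnn.
Qed.

(* Eigenvalues repeated with algebraic multiplicity, in nonincreasing order;
   junk value [::] when the characteristic polynomial does not split over R,
   which cannot happen for a symmetric matrix. *)
Definition eigenvalue_seq A : seq R :=
  xget [::] [set s | sorted >=%R s /\
                     char_poly A = \prod_(a <- s) ('X - a%:P)].

Definition singular_values A : seq R :=
  [seq Num.sqrt a | a <- eigenvalue_seq (A^T *m A)].

Definition second_singular_value A : R := (singular_values A)`_1.

End Spectrum.

Section Network.
Context {R : realType} {N : nat}.

Definition connected_graph (e : rel 'I_N) : Prop :=
  [/\ symmetric e, irreflexive e & forall i j, connect e i j].

Record communication_matrix (e : rel 'I_N) (W : 'M[R]_N) : Prop := {
  comm_support : forall i j, i != j -> ~~ e i j -> W i j = 0;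
  comm_sym : W^T = W;
  comm_ge0 : forall i j, 0 <= W i j;
  comm_row : forall i, \sum_j W i j = 1;
  comm_col : forall j, \sum_i W i j = 1;
  comm_diag : forall i, 0 < W i i < 1;
  comm_eigen : forall a, eigenvalue W a -> -1 < a <= 1;
  comm_singular : 0 <= second_singular_value W < 1
}.

End Network.

Section Stiefel.
Context {R : realType} {d r : nat}.
Implicit Types x y : 'M[R]_(d, r).

Definition stiefel : set 'M[R]_(d, r) := [set x | x^T *m x = 1%:M].

(* The library's norm `|x| on matrices is the sup norm, hence the explicit
   Frobenius product and norm. *)
Definition frob_dot x y : R := \tr (x^T *m y).
Definition frob_norm x : R := Num.sqrt (frob_dot x x).

Definition tangent_proj x y : 'M[R]_(d, r) :=
  y - 2^-1 *: (x *m (x^T *m y + y^T *m x)).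

End Stiefel.

Section Consensus.
Context {R : realType} {d r N : nat}.
Implicit Types x y : {ffun 'I_N -> 'M[R]_(d, r)}.

Definition stack_dot x y : R := \sum_i frob_dot (x i) (y i).
Definition stack_norm x : R := Num.sqrt (stack_dot x x).

Variables (W : 'M[R]_N) (t : nat).

Definition consensus x : R :=
  4^-1 * \sum_i \sum_j (W ^+ t) i j * frob_norm (x i - x j) ^+ 2.

Definition egrad x : {ffun 'I_N -> 'M[R]_(d, r)} :=
  [ffun i => x i - \sum_j (W ^+ t) i j *: x j].

Definition rgrad x : {ffun 'I_N -> 'M[R]_(d, r)} :=
  [ffun i => tangent_proj (x i) (egrad x i)].

End Consensus.

(* Main.v *)
Require Import Defs.
From mathcomp Require Import all_boot all_order all_algebra.
From mathcomp Require Import classical_sets reals.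
From mathcomp Require Import complex ring lra.

Set Implicit Arguments.
Unset Strict Implicit.
Unset Printing Implicit Defensive.

Import Order.TTheory GRing.Theory Num.Theory.
Local Open Scope ring_scope.

(* With A = W^t, the function is a quadratic form, so its second-order Taylor
   remainder is (1/2) <z, (I - A) z> for z = y - x, which the Rayleigh bound
   for A estimates by (L/2) |z|^2. It remains to replace the Euclidean gradient
   g by the Riemannian one: g_i - grad_i = x_i S_i / 2 with
   S_i = x_i^T g_i + g_i^T x_i, and orthonormality of x and y gives
   <x_i S_i, y_i - x_i> = - tr (S_i z_i^T z_i) / 2. As x_i^T x_i = I and A is
   stochastic, S_i = sum_j A_ij (x_i - x_j)^T (x_i - x_j) is positive
   semidefinite, so the normal component has a favourable sign. *)

(** * Rayleigh bound for real symmetric matrices *)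

Section Rayleigh.
Local Open Scope sesquilinear_scope.
Local Open Scope complex_scope.

(** Over [R[i]] the image [B] of [A] is Hermitian, so B = P^* D P with P unitary. In the coordinates
    w = u P^* the two sides become the sums of m |w_i|^2 and of D_i |w_i|^2, compared term by
    term. *)
Lemma rayleigh_ge (R : rcfType) n (A : 'M[R]_n) (m : R) (v : 'rV[R]_n) :
    A^T = A -> (forall a, eigenvalue A a -> m <= a) ->
  m * (v *m v^T) 0 0 <= (v *m A *m v^T) 0 0.
Proof.
move=> Asym mA.
pose f : {rmorphism R -> R[i]} := real_complex R.
pose B := map_mx f A; pose u := map_mx f v.
have uC : u ^t* = map_mx f v^T.
  by apply/matrixP => i j; rewrite !mxE; apply: conj_Creal; rewrite complex_real.
have Bherm : B \is hermsymmx.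
  apply: realsym_hermsym.
    apply/is_hermitianmxP; rewrite expr0 scale1r map_mx_id //.
    by rewrite /B map_trmx Asym.
  by apply/mxOverP => i j; rewrite mxE complex_real.
set P := spectralmx B; set D := spectral_diag B.
have Pu : P \is unitarymx := spectral_unitarymx B.
have BE : B = P ^t* *m diag_mx D *m P.
  rewrite -invmx_unitary //; apply/orthomx_spectralP.
  exact: hermitian_normalmx.
have PP : P ^t* *m P = 1%:M by rewrite -invmx_unitary // mulVmx ?unitarymx_unit.
pose w := u *m P ^t*.
have wC : w ^t* = P *m u ^t* by rewrite trmx_mul map_mxM trmxCK.
(* Each D_i is real because [B] is Hermitian. It is an eigenvalue of [B] with eigenvector row i of
   [P], and being a root of the characteristic polynomial descends to [A] along the embedding
   [f]. *)
have DE i : {a | D 0 i = a%:C & m <= a}.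
  have /mxOverP/(_ 0 i)/RRe_real Dr := hermitian_spectral_diag_real Bherm.
  exists (complex.Re (D 0 i)); first by rewrite Dr.
  apply: mA; rewrite eigenvalue_root_char -(fmorph_root f) /= map_char_poly.
  rewrite [f _]Dr -eigenvalue_root_char; apply/eigenvalueP; exists (row i P).
    rewrite -/B -/D [in LHS]BE -row_mul !mulmxA (unitarymxP Pu) mul1mx row_mul.
    by rewrite row_diag_mx -scalemxAl -rowE.
  (* Row i of [P] is nonzero since entry i of its product with P^* is 1. *)
  apply/eqP => /(congr1 (fun z => (z *m P ^t*) 0 i)).
  rewrite -row_mul (unitarymxP Pu) mul0mx !mxE eqxx => /eqP.
  by rewrite oner_eq0.
rewrite -lecR -[(_ * _)%:C]/(f _) rmorphM /=.
have -> : f ((v *m v^T) 0 0) = (w *m w ^t*) 0 0.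
  by rewrite wC mulmxA -[w *m P]mulmxA PP mulmx1 uC -map_mxM [RHS]mxE.
have -> : ((v *m A *m v^T) 0 0)%:C = (w *m diag_mx D *m w ^t*) 0 0.
  rewrite wC !mulmxA -[w *m _ *m P]mulmxA /w -!(mulmxA u) (mulmxA (P ^t*)) -BE.
  by rewrite uC mulmxA -!map_mxM [RHS]mxE.
rewrite mul_mx_diag !mxE mulr_sumr ler_sum // => i _.
have [a Da ma] := DE i.
rewrite [in leRHS]mxE Da [w 0 i * a%:C]mulrC -mulrA.
apply: ler_wpM2r; last by rewrite lecR.
by rewrite [(w ^t*) _ _]mxE [w^T _ _]mxE mul_conjC_ge0.
Qed.

End Rayleigh.

(** * Symmetric stochastic matrices and their powers *)

Lemma stochastic_expmx (R : numDomainType) N (W : 'M[R]_N) t :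
    W^T = W -> (forall i j, 0 <= W i j) -> (forall i, \sum_j W i j = 1) ->
  [/\ (W ^+ t)^T = W ^+ t, forall i j, 0 <= (W ^+ t) i j
    & forall i, \sum_j (W ^+ t) i j = 1].
Proof.
move=> Wsym W0 W1; elim: t => [|t [Ssym S0 S1]].
  rewrite expr0; split=> [|i j|i]; first exact: trmx1.
    by rewrite mxE ler0n.
  rewrite (bigD1 i) //= big1 ?mxE ?eqxx ?addr0 // => j /negPf ji.
  by rewrite mxE eq_sym ji.
split=> [|i j|i].
- rewrite {1}exprS trmx_mul Wsym Ssym; exact/esym/exprSr.
- by rewrite exprS mxE sumr_ge0 // => k _; rewrite mulr_ge0.
- under eq_bigr do rewrite exprS mxE.
  rewrite exchange_big /= -[RHS](W1 i); apply: eq_bigr => k _.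
  by rewrite -mulr_sumr S1 mulr1.
Qed.

(** The all-ones row vector is a left eigenvector, since by symmetry the columns also sum to 1. This
    supplies the eigenvalue that rules out the junk value of [smallest_eigenvalue]. *)
Lemma eigenvalue1_stochastic (R : fieldType) N (A : 'M[R]_N) :
    (0 < N)%N -> A^T = A -> (forall i, \sum_j A i j = 1) -> eigenvalue A 1.
Proof.
move=> N0 Asym A1; apply/eigenvalueP; exists (const_mx 1).
  apply/rowP => j; rewrite !mxE mul1r -[RHS](A1 j); apply: eq_bigr => i _.
  by rewrite mxE mul1r -[in LHS]Asym mxE.
apply/eqP => /rowP /(_ (Ordinal N0)) /eqP.
by rewrite !mxE oner_eq0.
Qed.

(** * Frobenius product and the Stiefel constraint *)

Section Frobenius.
Context {R : realType} {d r : nat}.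
Implicit Types x y z : 'M[R]_(d, r).

Lemma frob_dotE x y : frob_dot x y = \sum_j \sum_i x i j * y i j.
Proof.
by apply: eq_bigr => j _; rewrite mxE; apply: eq_bigr => i _; rewrite mxE.
Qed.

Lemma frob_dotC x y : frob_dot x y = frob_dot y x.
Proof. by rewrite /frob_dot -mxtrace_tr trmx_mul trmxK. Qed.

Lemma frob_dotDl x y z : frob_dot (x + y) z = frob_dot x z + frob_dot y z.
Proof. by rewrite /frob_dot raddfD mulmxDl raddfD. Qed.

Lemma frob_dotBl x y z : frob_dot (x - y) z = frob_dot x z - frob_dot y z.
Proof. by rewrite /frob_dot raddfB mulmxBl raddfB. Qed.

Lemma frob_dotDr x y z : frob_dot z (x + y) = frob_dot z x + frob_dot z y.
Proof. by rewrite !(frob_dotC z) frob_dotDl. Qed.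

Lemma frob_dotBr x y z : frob_dot z (x - y) = frob_dot z x - frob_dot z y.
Proof. by rewrite !(frob_dotC z) frob_dotBl. Qed.

Lemma frob_dotZl a x y : frob_dot (a *: x) y = a * frob_dot x y.
Proof. by rewrite /frob_dot linearZ -scalemxAl mxtraceZ. Qed.

Lemma frob_dot_suml (I : finType) (F : I -> 'M[R]_(d, r)) y :
  frob_dot (\sum_i F i) y = \sum_i frob_dot (F i) y.
Proof. by rewrite /frob_dot raddf_sum mulmx_suml raddf_sum. Qed.

Lemma frob_dot_ge0 x : 0 <= frob_dot x x.
Proof.
by rewrite frob_dotE; do 2![apply: sumr_ge0 => ? _]; rewrite -expr2 sqr_ge0.
Qed.

Lemma frob_norm_sqr x : frob_norm x ^+ 2 = frob_dot x x.
Proof. by rewrite sqr_sqrtr ?frob_dot_ge0. Qed.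

(** Orthonormality gives (y - x)^T (y - x) = 2 I - y^T x - x^T y, and transposing under the trace
    identifies the two cross terms because [S] is symmetric. Both sides equal tr (S x^T y) - tr
    S. *)
Lemma frob_dot_stiefel_sym x y (S : 'M[R]_r) :
    stiefel x -> stiefel y -> S^T = S ->
  frob_dot (x *m S) (y - x) = - 2^-1 * \tr (S *m ((y - x)^T *m (y - x))).
Proof.
rewrite /stiefel /= => hx hy Ssym.
have trS : \tr (S *m (y^T *m x)) = \tr (S *m (x^T *m y)).
  by rewrite -mxtrace_tr !trmx_mul trmxK Ssym mxtrace_mulC.
have gramB : (y - x)^T *m (y - x) = 1%:M - y^T *m x - (x^T *m y - 1%:M).
  by rewrite [(y - x)^T]raddfB mulmxBl !mulmxBr hx hy.
rewrite gramB /frob_dot trmx_mul Ssym -mulmxA !mulmxBr hx !raddfB /= trS.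
by field.
Qed.

End Frobenius.

(** By cyclicity the trace is the squared Frobenius norm of y z^T. *)
Lemma tr_gram_mul_ge0 (R : realType) d r (y z : 'M[R]_(d, r)) :
  0 <= \tr (y^T *m y *m (z^T *m z)).
Proof.
have := frob_dot_ge0 (y *m z^T); rewrite /frob_dot trmx_mul trmxK.
by rewrite mxtrace_mulC mulmxA mxtrace_mulC !mulmxA.
Qed.

(** * The consensus function as a quadratic form, and its two gradients *)

Section Consensus.
Context {R : realType} {d r N : nat}.
Variables (W : 'M[R]_N) (t : nat).
Implicit Types x y z : {ffun 'I_N -> 'M[R]_(d, r)}.
Let A := W ^+ t.

Lemma stack_norm_sqr x : stack_norm x ^+ 2 = stack_dot x x.
Proof. by rewrite sqr_sqrtr // sumr_ge0 // => i _; exact: frob_dot_ge0. Qed.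

Lemma stack_dot_egradE x y : stack_dot (egrad W t x) y =
  stack_dot x y - \sum_i \sum_j A i j * frob_dot (x j) (y i).
Proof.
rewrite -sumrB; apply: eq_bigr => i _; rewrite ffunE frob_dotBl frob_dot_suml.
by congr (_ - _); apply: eq_bigr => j _; rewrite frob_dotZl.
Qed.

Lemma stack_dot_egradDl x y z :
  stack_dot (egrad W t (x + y)) z =
    stack_dot (egrad W t x) z + stack_dot (egrad W t y) z.
Proof.
rewrite -big_split; apply: eq_bigr => i _ /=; rewrite -frob_dotDl; congr frob_dot.
rewrite !ffunE addrACA -opprD -big_split; congr (_ - _).
by apply: eq_bigr => j _; rewrite ffunE scalerDr.
Qed.

Lemma stack_dotDr x y z : stack_dot z (x + y) = stack_dot z x + stack_dot z y.
Proof.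
by rewrite -big_split; apply: eq_bigr => i _; rewrite ffunE frob_dotDr.
Qed.

Hypothesis Asym : A^T = A.

Lemma stack_dot_egradC x y :
  stack_dot (egrad W t x) y = stack_dot (egrad W t y) x.
Proof.
rewrite !stack_dot_egradE; congr (_ - _).
  by apply: eq_bigr => i _; rewrite frob_dotC.
rewrite exchange_big; apply: eq_bigr => i _; apply: eq_bigr => j _ /=.
by rewrite frob_dotC -[in LHS]Asym mxE.
Qed.

Hypothesis A1 : forall i, \sum_j A i j = 1.

(** In the expansion of |x_i - x_j|^2, the two square terms each sum to |x|^2, one by the row sums
    and one by the column sums of [A]. *)
Lemma consensusE x : consensus W t x = 2^-1 * stack_dot (egrad W t x) x.
Proof.
pose n i := frob_dot (x i) (x i).
have rowA : \sum_i \sum_j A i j * n i = stack_dot x x.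
  by apply: eq_bigr => i _; rewrite -mulr_suml A1 mul1r.
have colA : \sum_i \sum_j A i j * n j = stack_dot x x.
  rewrite exchange_big -rowA; apply: eq_bigr => i _; apply: eq_bigr => j _ /=.
  by rewrite -[in LHS]Asym mxE.
rewrite stack_dot_egradE.
have -> : consensus W t x = 4^-1 * (\sum_i \sum_j A i j * n i
    + \sum_i \sum_j A i j * n j
    - 2 * \sum_i \sum_j A i j * frob_dot (x j) (x i)).
  congr (_ * _); rewrite mulr_sumr -big_split -sumrB; apply: eq_bigr => i _ /=.
  rewrite mulr_sumr -big_split -sumrB; apply: eq_bigr => j _ /=.
  rewrite frob_norm_sqr frob_dotBl !frob_dotBr (frob_dotC (x i) (x j)) /n /A.
  by ring.
by rewrite rowA colA; field.
Qed.

Lemma consensus_taylor x y :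
  consensus W t y - consensus W t x - stack_dot (egrad W t x) (y - x)
    = 2^-1 * stack_dot (egrad W t (y - x)) (y - x).
Proof.
have: y = x + (y - x) by rewrite addrC subrK.
move: (y - x) => z ->; rewrite !consensusE stack_dot_egradDl !stack_dotDr (stack_dot_egradC z x).
by field.
Qed.

(** [A] acts only on the node index, so the form splits over matrix entries (a, b), and the Rayleigh
    bound applies to each vector of entries z_i(a, b), i ranging over the nodes. *)
Lemma stack_dot_egrad_le m z : (forall a, eigenvalue A a -> m <= a) ->
  stack_dot (egrad W t z) z <= (1 - m) * stack_dot z z.
Proof.
move=> mA; rewrite stack_dot_egradE mulrBl mul1r lerD2l lerN2.
have -> : stack_dot z z = \sum_b \sum_a \sum_i z i a b * z i a b.
  rewrite /stack_dot; under eq_bigr do rewrite frob_dotE.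
  by rewrite exchange_big; apply: eq_bigr => b _; rewrite exchange_big.
have -> : \sum_i \sum_j A i j * frob_dot (z j) (z i) =
    \sum_b \sum_a \sum_i \sum_j z i a b * A i j * z j a b.
  under eq_bigr do under eq_bigr do rewrite frob_dotE mulr_sumr.
  under eq_bigr do rewrite exchange_big.
  rewrite exchange_big; apply: eq_bigr => b _ /=.
  under eq_bigr do under eq_bigr do rewrite mulr_sumr.
  under eq_bigr do rewrite exchange_big.
  rewrite exchange_big; apply: eq_bigr => a _ /=.
  by do 2![apply: eq_bigr => ? _]; rewrite mulrCA mulrC [A _ _ * _]mulrC.
rewrite mulr_sumr ler_sum // => b _; rewrite mulr_sumr ler_sum // => a _.
have := rayleigh_ge (\row_i z i a b) Asym mA; congr (_ * _ <= _); rewrite mxE.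
  by apply: eq_bigr => i _; rewrite !mxE.
rewrite exchange_big; apply: eq_bigr => j _.
by rewrite !mxE mulr_suml; apply: eq_bigr => i _; rewrite mxE.
Qed.

(** Row sums 1 turn x_i^T g_i into the weighted sum of I - x_i^T x_j; adding the transpose gives 2 I
    - x_i^T x_j - x_j^T x_i, the Gram matrix of x_i - x_j. *)
Lemma egrad_normal_part x i : (forall j, stiefel (x j)) ->
  (x i)^T *m egrad W t x i + (egrad W t x i)^T *m x i =
    \sum_j A i j *: ((x i - x j)^T *m (x i - x j)).
Proof.
rewrite /stiefel /= => hx.
have xg : (x i)^T *m egrad W t x i = \sum_j A i j *: (1%:M - (x i)^T *m x j).
  rewrite ffunE mulmxBr hx mulmx_sumr -[1%:M in LHS]scale1r -(A1 i) scaler_suml.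
  by rewrite -sumrB; apply: eq_bigr => j _; rewrite -scalemxAr -scalerBr.
have gx : (egrad W t x i)^T *m x i = ((x i)^T *m egrad W t x i)^T.
  by rewrite trmx_mul trmxK.
rewrite gx xg raddf_sum -big_split; apply: eq_bigr => j _ /=.
rewrite linearZ -scalerDr /= raddfB /= trmx1 trmx_mul trmxK; congr (_ *: _).
by rewrite [(x i - x j)^T]raddfB mulmxBl !mulmxBr !hx opprB addrC.
Qed.

Hypothesis A0 : forall i j, 0 <= A i j.

Lemma stack_dot_egrad_rgrad x y :
    (forall i, stiefel (x i)) -> (forall i, stiefel (y i)) ->
  stack_dot (egrad W t x) (y - x) <= stack_dot (rgrad W t x) (y - x).
Proof.
move=> hx hy; apply: ler_sum => i _; rewrite -subr_le0 -frob_dotBl.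
(* Only the normal component x_i S_i / 2 of the Euclidean gradient remains. *)
rewrite [rgrad W t x i]ffunE /tangent_proj opprB addrC subrK frob_dotZl.
rewrite pmulr_rle0 ?invr_gt0 //.
have -> : (y - x) i = y i - x i by rewrite !ffunE.
rewrite frob_dot_stiefel_sym //; last first.
  by rewrite raddfD /= !trmx_mul !trmxK addrC.
rewrite mulNr oppr_le0 mulr_ge0 ?invr_ge0 // egrad_normal_part // mulmx_suml.
rewrite raddf_sum sumr_ge0 // => j _ /=.
by rewrite -scalemxAl mxtraceZ mulr_ge0 // tr_gram_mul_ge0.
Qed.

End Consensus.

Theorem lemma4 (R : realType) (d r N t : nat)
    (hr : (1 <= r)%N) (hrd : (r <= d)%N) (hN : (2 <= N)%N) (ht : (1 <= t)%N)
    (e : rel 'I_N) (W : 'M[R]_N)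
    (he : connected_graph e) (hW : communication_matrix e W)
    (x y : {ffun 'I_N -> 'M[R]_(d, r)})
    (hx : forall i, stiefel (x i)) (hy : forall i, stiefel (y i)) :
  let L := 1 - smallest_eigenvalue (W ^+ t) in
  consensus W t y - (consensus W t x + stack_dot (rgrad W t x) (y - x))
    <= L / 2 * stack_norm (y - x) ^+ 2.
Proof.
cbv zeta.
have [Asym A0 A1] :=
  stochastic_expmx t (comm_sym hW) (comm_ge0 hW) (comm_row hW).
have [_ mA] := smallest_eigenvalueP
  (eigenvalue1_stochastic (ltnW hN) Asym A1).
have taylor := consensus_taylor Asym A1 x y.
have normal := stack_dot_egrad_rgrad A1 A0 hx hy.
have rayleigh := stack_dot_egrad_le Asym (y - x) mA.
(* Passing to [rgrad] can only lower the remainder, by [normal]; the Euclidean remainder is half the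
   form that [rayleigh] bounds. *)
by rewrite stack_norm_sqr; lra.
Qed.
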